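(* Let $\alpha>0$. For any quaternionic $\theta\ne0$, the inverse of $\widetilde{\mathcal{L}_\theta^\alpha}$ is given by $$(\widetilde{\mathcal{L}_\theta^\alpha})^{-1}=\mathcal{A}^{-1}\,\Gamma_\theta^{-1}\,\mathcal{A}=\widetilde{\mathcal{L}_{1/\theta}^\alpha}.$$
   Context: $\mathbb{H}$ denotes the quaternions, $\mathbb{B}=\{q\in\mathbb{H}:|q|<1\}$, $\mathbb{R}^+=(0,\infty)$. For $\alpha>0$, $L^{2,\alpha}_{\mathbb{H}}(\mathbb{R}^+)$ is the right quaternionic Hilbert space of functions $\varphi:\mathbb{R}^+\to\mathbb{H}$ square integrable with respect to the inner product $\langle\varphi,\psi\rangle_\alpha=\int_0^\infty\overline{\varphi(x)}\,\psi(x)\,x^\alpha e^{-x}\,dx$. The slice hyperholomorphic Bergman space of second kind is $$A^{2,\alpha}_{slice}(\mathbb{B})=\Big\{f(q)=\sum_{n=0}^\infty q^nc_n:\ c_n\in\mathbb{H},\ \sum_{n=0}^\infty\frac{n!}{\Gamma(\alpha+n+1)}|c_n|^2<\infty\Big\},$$ with inner product $\langle f,g\rangle=\int_{\mathbb{B}_I}\overline{f(z)}\,g(z)\,(1-|z|^2)^{\alpha-1}\,dx\,dy$, where $z=x+Iy$, $\mathbb{B}_I=\mathbb{B}\cap(\mathbb{R}+I\mathbb{R})$ and $I\in\mathbb{H}$ with $I^2=-1$ (the value does not depend on $I$). The second Bargmann transform $\mathcal{A}:L^{2,\alpha}_{\mathbb{H}}(\mathbb{R}^+)\to A^{2,\alpha}_{slice}(\mathbb{B})$,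 $$(\mathcal{A}\varphi)(q)=\frac{1}{\sqrt{\pi\Gamma(\alpha)}\,(1-q)^{\alpha+1}}\int_0^\infty\exp\Big(\frac{tq}{q-1}\Big)\varphi(t)\,t^\alpha e^{-t}\,dt,$$ is known to be a unitary isometry onto, with inverse $\mathcal{A}^{-1}$. For $\theta\in\mathbb{H}$ and $f(q)=\sum_{n=0}^\infty q^nc_n\in A^{2,\alpha}_{slice}(\mathbb{B})$, the action $\Gamma_\theta$ is $\Gamma_\theta f(q)=\sum_{n=0}^\infty q^n\theta^nc_n$. The transform $\widetilde{\mathcal{L}_\theta^\alpha}$ on $L^{2,\alpha}_{\mathbb{H}}(\mathbb{R}^+)$ is $\widetilde{\mathcal{L}_\theta^\alpha}=\mathcal{A}^{-1}\,\Gamma_\theta\,\mathcal{A}$, and $1/\theta=\theta^{-1}$ is the quaternionic inverse of $\theta$. *)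

(* Defs.v *)
From HB Require Import structures.
From mathcomp Require Import all_boot all_order all_algebra.
From mathcomp Require Import all_classical all_reals all_analysis.
From mathcomp Require Import ring lra.

Set Implicit Arguments.
Unset Strict Implicit.
Unset Printing Implicit Defensive.

Import Order.TTheory GRing.Theory Num.Theory.
Import numFieldTopology.Exports.

Local Open Scope classical_set_scope.
Local Open Scope ring_scope.

(** * Quaternions *)

(* Quat a b c d is a + b i + c j + d k. *)
Record quat (R : Type) := Quat { q0 : R; q1 : R; q2 : R; q3 : R }.
Arguments q0 {R} q.
Arguments q1 {R} q.
Arguments q2 {R} q.
Arguments q3 {R} q.

Section QuatChoice.
Context {R : choiceType}.

Definition quat_tuple (q : quat R) := (q0 q, q1 q, q2 q, q3 q).
Definition tuple_quat (t : R * R * R * R) :=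
  let: (a, b, c, d) := t in Quat a b c d.

Lemma quat_tupleK : cancel quat_tuple tuple_quat. Proof. by case. Qed.

HB.instance Definition _ := Choice.copy (quat R) (can_type quat_tupleK).

End QuatChoice.

Lemma quat_eq (R : Type) (p q : quat R) :
  q0 p = q0 q -> q1 p = q1 q -> q2 p = q2 q -> q3 p = q3 q -> p = q.
Proof. by case: p q => [a b c d] [a' b' c' d'] /= -> -> -> ->. Qed.

Section QuatAlgebra.
Context {R : rcfType}.
Implicit Types (p q : quat R) (a : R).

Definition addq p q :=
  Quat (q0 p + q0 q) (q1 p + q1 q) (q2 p + q2 q) (q3 p + q3 q).
Definition oppq q := Quat (- q0 q) (- q1 q) (- q2 q) (- q3 q).
Definition scaleq a q := Quat (a * q0 q) (a * q1 q) (a * q2 q) (a * q3 q).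
Definition mulq p q := Quat
  (q0 p * q0 q - q1 p * q1 q - q2 p * q2 q - q3 p * q3 q)
  (q0 p * q1 q + q1 p * q0 q + q2 p * q3 q - q3 p * q2 q)
  (q0 p * q2 q - q1 p * q3 q + q2 p * q0 q + q3 p * q1 q)
  (q0 p * q3 q + q1 p * q2 q - q2 p * q1 q + q3 p * q0 q).

Let addqA : associative addq.
Proof. by move=> p q r; apply: quat_eq => /=; ring. Qed.
Let addqC : commutative addq.
Proof. by move=> p q; apply: quat_eq => /=; ring. Qed.
Let add0q : left_id (Quat 0 0 0 0) addq.
Proof. by move=> p; apply: quat_eq => /=; ring. Qed.
Let addNq : left_inverse (Quat 0 0 0 0) oppq addq.
Proof. by move=> p; apply: quat_eq => /=; ring. Qed.

HB.instance Definition _ :=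
  GRing.isZmodule.Build (quat R) addqA addqC add0q addNq.

Let mulqA : associative mulq.
Proof. by move=> p q r; apply: quat_eq => /=; ring. Qed.
Let mul1q : left_id (Quat 1 0 0 0) mulq.
Proof. by move=> p; apply: quat_eq => /=; ring. Qed.
Let mulq1 : right_id (Quat 1 0 0 0) mulq.
Proof. by move=> p; apply: quat_eq => /=; ring. Qed.
Let mulqDl : left_distributive mulq addq.
Proof. by move=> p q r; apply: quat_eq => /=; ring. Qed.
Let mulqDr : right_distributive mulq addq.
Proof. by move=> p q r; apply: quat_eq => /=; ring. Qed.
Let oneq_neq0 : Quat 1 0 0 0 != 0 :> quat R.
Proof. by apply/eqP => -[] /eqP; rewrite oner_eq0. Qed.

HB.instance Definition _ := GRing.Zmodule_isNzRing.Build (quat R)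
  mulqA mul1q mulq1 mulqDl mulqDr oneq_neq0.

Let scaleqA a b q : scaleq a (scaleq b q) = scaleq (a * b) q.
Proof. by apply: quat_eq => /=; ring. Qed.
Let scale1q : left_id 1 scaleq.
Proof. by move=> p; apply: quat_eq => /=; ring. Qed.
Let scaleqDr : right_distributive scaleq +%R.
Proof. by move=> a p q; apply: quat_eq => /=; ring. Qed.
Let scaleqDl q : {morph scaleq^~ q : a b / a + b}.
Proof. by move=> a b; apply: quat_eq => /=; ring. Qed.

HB.instance Definition _ := GRing.Zmodule_isLmodule.Build R (quat R)
  scaleqA scale1q scaleqDr scaleqDl.

Let scaleqAl a p q : a *: (p * q) = (a *: p) * q.
Proof. by apply: quat_eq => /=; ring. Qed.
HB.instance Definition _ := GRing.Lmodule_isLalgebra.Build R (quat R) scaleqAl.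

Let scaleqAr a p q : a *: (p * q) = p * (a *: q).
Proof. by apply: quat_eq => /=; ring. Qed.
HB.instance Definition _ := GRing.Lalgebra_isAlgebra.Build R (quat R) scaleqAr.

Definition sqnormq q := q0 q ^+ 2 + q1 q ^+ 2 + q2 q ^+ 2 + q3 q ^+ 2.
Definition conjq q := Quat (q0 q) (- q1 q) (- q2 q) (- q3 q).
Definition invq q := (sqnormq q)^-1 *: conjq q.
Definition normq q := Num.sqrt (sqnormq q).

Lemma sqnormq_ge0 q : 0 <= sqnormq q.
Proof. by rewrite !addr_ge0 ?sqr_ge0. Qed.

Lemma sqnormq_eq0 q : (sqnormq q == 0) = (q == 0).
Proof.
apply/eqP/eqP => [|->]; last by rewrite /sqnormq /= !expr0n /= !addr0.
rewrite /sqnormq => /eqP; rewrite !paddr_eq0 ?addr_ge0 ?sqr_ge0// !sqrf_eq0.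
by move=> /andP[/andP[/andP[/eqP ? /eqP ?] /eqP ?] /eqP ?]; apply: quat_eq.
Qed.

Let invqK0 q : q != 0 -> (sqnormq q)^-1 * sqnormq q = 1.
Proof. by move=> q0; rewrite mulVf ?sqnormq_eq0. Qed.

Let mulVq : {in [pred q | q != 0], left_inverse 1 invq *%R}.
Proof.
move=> q /invqK0 qK; rewrite /invq -scalerAl.
have -> : conjq q * q = sqnormq q *: 1.
  by apply: quat_eq; rewrite /sqnormq /=; ring.
by rewrite scalerA qK scale1r.
Qed.

Let mulqV : {in [pred q | q != 0], right_inverse 1 invq *%R}.
Proof.
move=> q /invqK0 qK; rewrite /invq -scalerAr.
have -> : q * conjq q = sqnormq q *: 1.
  by apply: quat_eq; rewrite /sqnormq /=; ring.
by rewrite scalerA qK scale1r.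
Qed.

Let unitqP p q : q * p = 1 /\ p * q = 1 -> p \in [pred q | q != 0].
Proof.
by move=> [qp _]; apply/eqP => p0; move: qp; rewrite p0 mulr0 => /esym/eqP;
  rewrite oner_eq0.
Qed.

Let invq_out : {in [predC [pred q | q != 0]], invq =1 id}.
Proof.
by move=> q /negPn/eqP ->; rewrite /invq; apply: quat_eq => /=;
  rewrite ?oppr0 mulr0.
Qed.

HB.instance Definition _ := GRing.NzRing_hasMulInverse.Build (quat R)
  mulVq mulqV unitqP invq_out.

Let normqD p q : normq (p + q) <= normq p + normq q.
Proof.
rewrite /normq -[leRHS]ger0_norm ?addr_ge0 ?sqrtr_ge0//.
rewrite -sqrtr_sqr ler_wsqrtr// sqrrD !sqr_sqrtr ?sqnormq_ge0//.
pose d := q0 p * q0 q + q1 p * q1 q + q2 p * q2 q + q3 p * q3 q.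
have -> : sqnormq (p + q) = sqnormq p + d *+ 2 + sqnormq q.
  by rewrite /sqnormq /d /=; ring.
rewrite lerD2r lerD2l lerMn2r/= -sqrtrM ?sqnormq_ge0//.
apply: le_trans (ler_norm _) _; rewrite -sqrtr_sqr ler_wsqrtr//.
rewrite -subr_ge0; set D := (X in 0 <= X).
have -> : D = (q0 p * q1 q - q1 p * q0 q) ^+ 2
  + (q0 p * q2 q - q2 p * q0 q) ^+ 2 + (q0 p * q3 q - q3 p * q0 q) ^+ 2
  + (q1 p * q2 q - q2 p * q1 q) ^+ 2 + (q1 p * q3 q - q3 p * q1 q) ^+ 2
  + (q2 p * q3 q - q3 p * q2 q) ^+ 2 by rewrite /D /d /sqnormq; ring.
by rewrite !addr_ge0 ?sqr_ge0.
Qed.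

Let normq0_eq0 q : normq q = 0 -> q = 0.
Proof.
move=> /eqP; rewrite sqrtr_eq0 => q0; apply/eqP.
by rewrite -sqnormq_eq0 eq_le q0 sqnormq_ge0.
Qed.

Let normqMn q n : normq (q *+ n) = normq q *+ n.
Proof.
rewrite -scaler_nat /normq.
have -> : sqnormq (n%:R *: q) = n%:R ^+ 2 * sqnormq q.
  by rewrite /sqnormq /=; ring.
by rewrite sqrtrM ?sqr_ge0// sqrtr_sqr normr_nat mulr_natl.
Qed.

Let normqN q : normq (- q) = normq q.
Proof. by rewrite /normq /sqnormq /= !sqrrN. Qed.

HB.instance Definition _ := Num.Zmodule_isNormed.Build R (quat R)
  normqD normq0_eq0 normqMn normqN.

End QuatAlgebra.

(** * Quaternionic analysis *)

Section QuatAnalysis.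
Context {R : realType}.
Implicit Types (p q : quat R) (u c : nat -> quat R).

Definition limq u : quat R :=
  Quat (limn (q0 \o u)) (limn (q1 \o u)) (limn (q2 \o u)) (limn (q3 \o u)).

Definition integralq (D : set R) (f : R -> quat R) : quat R :=
  let mu := @lebesgue_measure R in
  Quat (\int[mu]_(x in D) q0 (f x)) (\int[mu]_(x in D) q1 (f x))
       (\int[mu]_(x in D) q2 (f x)) (\int[mu]_(x in D) q3 (f x)).

Definition expq q : quat R :=
  limq (fun N => \sum_(n < N) (n`!%:R^-1 : R) *: q ^+ n).

Definition vecq q : quat R := Quat 0 (q1 q) (q2 q) (q3 q).

(* Principal logarithm on the quaternions off the closed negative half-line:
   writing q = |q| exp(J t) with J a unit imaginary and 0 <= t < pi, its value
   is ln |q| + J t. *)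
Definition lnq q : quat R :=
  ln `|q| *: 1 + acos (q0 q / `|q|) *: (`|vecq q|^-1 *: vecq q).

Definition powq q (a : R) : quat R := expq (a *: lnq q).

Definition ballq := {q : quat R | `|q| < 1}.

(* f(q) = \sum_n q^n c_n on the unit ball. *)
Definition has_power_series (f : ballq -> quat R) c :=
  forall q : ballq,
    (fun N => `|f q - \sum_(n < N) val q ^+ n * c n|) @ \oo --> (0 : R).

Definition Gamma (s : R) : R :=
  \int[@lebesgue_measure R]_(t in `]0, +oo[%classic)
    (t `^ (s - 1) * expR (- t)).

End QuatAnalysis.
Arguments ballq : clear implicits.

(** * The weighted space L^2 *)

Section L2.
Context {R : realType} (alpha : R).
Local Notation mu := (@lebesgue_measure R).
Local Notation Rpos := (`]0, +oo[%classic : set R).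

Definition square_integrable : set (R -> quat R) :=
  [set phi : R -> quat R | [/\ measurable_fun Rpos (q0 \o phi),
                 measurable_fun Rpos (q1 \o phi),
                 measurable_fun Rpos (q2 \o phi),
                 measurable_fun Rpos (q3 \o phi) &
    (\int[mu]_(x in Rpos) (`|phi x| ^+ 2 * x `^ alpha * expR (- x))%:E
       < +oo)%E]].

Definition ae_eqq (phi psi : square_integrable) : bool :=
  `[< ae_eq mu Rpos (val phi) (val psi) >].

Let ae_eqq_refl : reflexive ae_eqq.
Proof. by move=> f; apply/asboolP/ae_eq_refl. Qed.
Let ae_eqq_sym : symmetric ae_eqq.
Proof. by move=> f g; apply/idP/idP => /asboolP h; apply/asboolP/ae_eq_sym. Qed.
Let ae_eqq_trans : transitive ae_eqq.
Proof.
by move=> f g h /asboolP gf /asboolP fh; apply/asboolP/(ae_eq_trans gf fh).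
Qed.

Canonical ae_eqq_equiv := EquivRel ae_eqq ae_eqq_refl ae_eqq_sym ae_eqq_trans.

Definition L2 : Type := {eq_quot ae_eqq}%qT.
HB.instance Definition _ := Choice.on L2.
HB.instance Definition _ := EqQuotient.on L2.

Definition L2_fun (phi : L2) : R -> quat R := val (repr phi).

End L2.

(** * The operators *)

(* Operators, possibly not everywhere defined, are represented by their graphs:
   the dilation below is unbounded when |theta| > 1.  Composition and inverse
   are those of relation_scope, where B \; A applies A first. *)
Definition single_valued (X Y : Type) (G : set (X * Y)) :=
  forall x y y', G (x, y) -> G (x, y') -> y = y'.

Section Operators.
Context {R : realType} (alpha : R).

Definition bergman_coef (c : nat -> quat R) : Prop :=
  (\sum_(0 <= n <oo)
     (n`!%:R / Gamma (alpha + n%:R + 1) * `|c n| ^+ 2)%:E < +oo)%E.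

Definition slice_bergman : set (ballq R -> quat R) :=
  [set f | exists2 c, bergman_coef c & has_power_series f c].

Definition bargmann (phi : L2 alpha) (q : ballq R) : quat R :=
  (Num.sqrt (pi * Gamma alpha))^-1 *: (powq (1 - val q) (alpha + 1))^-1 *
  integralq `]0, +oo[%classic (fun t => (t `^ alpha * expR (- t)) *:
    (expq (t *: (val q / (val q - 1))) * L2_fun phi t)).

Definition bargmann_graph : set (L2 alpha * (ballq R -> quat R)) :=
  [set x | slice_bergman x.2 /\ x.2 = bargmann x.1].

(* The action Gamma_theta on its maximal domain: those f in the Bergman space
   for which \sum_n q^n theta^n c_n is again in the Bergman space. *)
Definition dilation_graph (theta : quat R) :
    set ((ballq R -> quat R) * (ballq R -> quat R)) :=
  [set x | exists c : nat -> quat R,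
    [/\ bergman_coef c, has_power_series x.1 c,
        bergman_coef (fun n => theta ^+ n * c n) &
        has_power_series x.2 (fun n => theta ^+ n * c n)]].

Definition Ltilde (theta : quat R) : set (L2 alpha * L2 alpha) :=
  (bargmann_graph^-1 \; dilation_graph theta \; bargmann_graph)%relation.

End Operators.

Arguments bargmann {R} alpha phi q.
Arguments bargmann_graph {R} alpha.
Arguments dilation_graph {R} alpha theta.
Arguments Ltilde {R} alpha theta.

(* Main.v *)
From HB Require Import structures.
Require Import Defs.
From mathcomp Require Import all_boot all_order all_algebra.
From mathcomp Require Import all_classical all_reals all_analysis.
From mathcomp Require Import measurable_realfun ring lra.

(** On coefficient sequences the dilation by [theta] multiplies [c n] by
[theta ^+ n], so for [theta != 0] it is undone by the dilation by [theta^-1]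
([dilation_graphV]).  Conjugating by the Bargmann transform [A] gives the two
formulas for the inverse.  For graphs these formulas are formal; the analytic
content is that the graphs are graphs of functions, which needs two uniqueness
theorems.

The dilation is single valued because a power series on the quaternionic unit
ball determines its coefficients ([has_power_series_coef_inj]).  At a real point
[x] the quaternionic series splits into four real power series in [x], so the
claim is the identity theorem for real power series on (0, 1).

The relation [A^-1] is single valued because [A] is injective on L^2
([bargmann_inj]).  The real point [q = s / (1 + s)] of the ball, with [s >= 0],
satisfies [q / (q - 1) = - s], so the coordinates of [A phi] there are, up to a
nonzero real factor, the Laplace transforms at [s] of the coordinates of
[t `^ alpha * expR (- t) * phi t].  Injectivity of [A] is thus injectivity of
the Laplace transform on integrable functions of the half-line
([laplace_eq0_ae]).

For the latter, let all integrals of [g t * expR (- (s * t))] vanish.  Then [g]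
integrates to zero against every polynomial in [expR (- (c * t))], in particular
against [(1 - expR (- (c * t)) ^+ n) ^+ (2 ^ n)].  As [n] grows, these
functions, bounded by 1, converge to the indicator of [t > ln 2 / c].  By
dominated convergence [g] integrates to zero over every half-line, hence over
every interval, and it vanishes almost everywhere by differentiation of the
integral.

The nonzero factor involves [Gamma alpha], which has to be shown finite and
positive.  Finiteness of the Gamma integral at [alpha + 1] also makes
[t `^ alpha * expR (- t) * phi t] integrable for square integrable [phi]. *)

Set Implicit Arguments.
Unset Strict Implicit.
Unset Printing Implicit Defensive.

Import Order.TTheory GRing.Theory Num.Theory.
Import numFieldNormedType.Exports.

Local Open Scope classical_set_scope.
Local Open Scope ring_scope.

(** * Real coordinates and real points of the quaternions *)

Section QuatCoordinates.
Context {R : rcfType}.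
Implicit Types q : quat R.

Let q0_linear : linear (@q0 R : quat R -> R^o). Proof. by []. Qed.
HB.instance Definition _ :=
  GRing.isLinear.Build R (quat R) R^o *:%R (@q0 R) q0_linear.
Let q1_linear : linear (@q1 R : quat R -> R^o). Proof. by []. Qed.
HB.instance Definition _ :=
  GRing.isLinear.Build R (quat R) R^o *:%R (@q1 R) q1_linear.
Let q2_linear : linear (@q2 R : quat R -> R^o). Proof. by []. Qed.
HB.instance Definition _ :=
  GRing.isLinear.Build R (quat R) R^o *:%R (@q2 R) q2_linear.
Let q3_linear : linear (@q3 R : quat R -> R^o). Proof. by []. Qed.
HB.instance Definition _ :=
  GRing.isLinear.Build R (quat R) R^o *:%R (@q3 R) q3_linear.

Lemma normq_real (r : R) : `|r *: (1 : quat R)| = `|r|.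
Proof.
rewrite [LHS](_ : _ = Num.sqrt (sqnormq (r *: 1)))// -sqrtr_sqr.
by congr Num.sqrt; rewrite /sqnormq /=; ring.
Qed.

Lemma sqr_normq q : `|q| ^+ 2 = sqnormq q.
Proof. by rewrite sqr_sqrtr ?sqnormq_ge0. Qed.

Lemma normr_coord_le q : [/\ `|q0 q| <= `|q|, `|q1 q| <= `|q|,
  `|q2 q| <= `|q| & `|q3 q| <= `|q|].
Proof.
have le (c r : R) : sqnormq q = c ^+ 2 + r -> 0 <= r -> `|c| <= `|q|.
  move=> qE r0; rewrite -(@ler_pXn2r _ 2) ?nnegrE// sqr_normq qE.
  by rewrite real_normK ?num_real// lerDl.
split.
- apply: (@le _ (q1 q ^+ 2 + q2 q ^+ 2 + q3 q ^+ 2)).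
    by rewrite /sqnormq; ring.
  by rewrite !addr_ge0 ?sqr_ge0.
- apply: (@le _ (q0 q ^+ 2 + q2 q ^+ 2 + q3 q ^+ 2)).
    by rewrite /sqnormq; ring.
  by rewrite !addr_ge0 ?sqr_ge0.
- apply: (@le _ (q0 q ^+ 2 + q1 q ^+ 2 + q3 q ^+ 2)).
    by rewrite /sqnormq; ring.
  by rewrite !addr_ge0 ?sqr_ge0.
- apply: (@le _ (q0 q ^+ 2 + q1 q ^+ 2 + q2 q ^+ 2)).
    by rewrite /sqnormq; ring.
  by rewrite !addr_ge0 ?sqr_ge0.
Qed.

End QuatCoordinates.

Section RealQuaternions.
Context {R : realType}.
Implicit Types r a x : R.

Lemma expq_real r : expq (r *: (1 : quat R)) = expR r *: 1.
Proof.
pose S (N : nat) : R := \sum_(n < N) r ^+ n / n`!%:R.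
rewrite /expq.
have -> : (fun N => \sum_(n < N) (n`!%:R^-1 : R) *: (r *: (1 : quat R)) ^+ n) =
    (fun N => S N *: (1 : quat R)).
  apply/funext => N; rewrite /S scaler_suml; apply: eq_bigr => n _.
  by rewrite exprZn expr1n scalerA mulrC.
have lim0 (pi : quat R -> R) : (forall N, pi (S N *: 1) = 0) ->
    limn (pi \o (fun N => S N *: (1 : quat R))) = expR r * 0.
  move=> pi0; rewrite mulr0 (_ : _ \o _ = cst 0) ?lim_cst//.
  exact/funext.
apply: quat_eq; rewrite /limq /=; [|exact/lim0/(fun N => mulr0 _)..].
rewrite mulr1 /expR; congr (limn _); apply/funext => N.
by rewrite /S /= mulr1 /series /= big_mkord; apply: eq_bigr.
Qed.

Lemma powq_real x a : 0 < x ->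
  powq (x *: (1 : quat R)) a = expR (a * ln x) *: 1.
Proof.
move=> x0; rewrite /powq /lnq.
have -> : vecq (x *: (1 : quat R)) = 0 by apply: quat_eq; rewrite /= ?mulr0.
by rewrite !scaler0 addr0 normq_real gtr0_norm// scalerA expq_real.
Qed.

Lemma invq_real r : r != 0 -> (r *: (1 : quat R))^-1 = r^-1 *: 1.
Proof.
move=> r0; have u : r *: (1 : quat R) \is a GRing.unit.
  by rewrite scaler_unit ?unitr1 ?unitfE.
apply: (mulrI u); rewrite mulrV//.
by rewrite -scalerAl mul1r scalerA mulfV// scale1r.
Qed.

End RealQuaternions.

(** * Uniqueness of power series coefficients *)

(** Convergence at 1/2 bounds [a n] by [M * 2 ^+ n], so for [x <= 1 / 4] every
partial sum is within [4 * M * x] of [a 0]; since the sums tend to 0, [a 0] is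
at most [4 * M * x] for all small [x]. *)
Lemma power_series_const_eq0 (R : realType) (a : nat -> R) :
  (forall x : R, 0 < x < 1 ->
    (fun N => \sum_(n < N) x ^+ n * a n) @ \oo --> (0 : R)) ->
  a 0%N = 0.
Proof.
move=> a0.
have [M [M0 aM]] : exists M : R, 0 < M /\ forall n, `|a n| <= M * 2 ^+ n.
  have h2 : 0 < (2^-1 : R) < 1 by lra.
  have [M [_ /(_ (`|M| + 1)) bndM]] := cvg_seq_bounded (cvgP _ (a0 _ h2)).
  have Mlt : M < `|M| + 1 by rewrite (le_lt_trans (ler_norm _))// ltrDl.
  have {}bndM := bndM Mlt; exists (2 * (`|M| + 1)); split.
    by rewrite mulr_gt0 ?ltr_pwDr.
  move=> n.
  (* a term of the series is a difference of two partial sums *)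
  have -> : a n = (\sum_(k < n.+1) 2^-1 ^+ k * a k
      - \sum_(k < n) 2^-1 ^+ k * a k) * 2 ^+ n.
    by rewrite big_ord_recr/= addrAC subrr add0r exprVn mulrAC mulVf ?mul1r.
  rewrite normrM (ger0_norm (exprn_ge0 _ _))// ler_wpM2r ?exprn_ge0//.
  by rewrite (le_trans (ler_normB _ _))// mulr_natl mulr2n lerD//; exact: bndM.
apply/eqP; rewrite -normr_eq0; apply/eqP/le_anti; rewrite normr_ge0 andbT.
apply/ler_addgt0Pr => e e0; rewrite add0r.
pose x := Num.min (1 / 4) (e / (4 * M)).
have x0 : 0 < x by rewrite lt_min divr_gt0// divr_gt0// mulr_gt0.
have x4 : x <= 1 / 4 by rewrite ge_min lexx.
have xe : 4 * M * x <= e.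
  by rewrite mulrC -ler_pdivlMr ?mulr_gt0// ge_min lexx orbT.
have x01 : 0 < x < 1 by lra.
have key N : `|a 0%N - \sum_(n < N.+1) x ^+ n * a n| <= e.
  rewrite big_ord_recl expr0 mul1r opprD addrA subrr add0r normrN.
  apply: le_trans xe; rewrite (le_trans (ler_norm_sum _ _ _))//.
  apply: (@le_trans _ _ (\sum_(i < N) 2 * M * x * (1 / 2) ^+ i)).
    apply: ler_sum => i _; rewrite lift0 normrM normrX gtr0_norm//.
    apply: (le_trans (ler_wpM2l _ (aM _))); first by rewrite exprn_ge0// ltW.
    rewrite mulrCA -exprMn exprS.
    have -> : M * (x * 2 * (x * 2) ^+ i) = 2 * M * x * (x * 2) ^+ i by ring.
    rewrite ler_wpM2l ?mulr_ge0 ?(ltW M0) ?(ltW x0)//.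
    by rewrite lerXn2r ?nnegrE//; lra.
  rewrite -mulr_sumr.
  have -> : 4 * M * x = 2 * M * x * 2 by ring.
  rewrite ler_wpM2l ?mulr_ge0 ?(ltW M0) ?(ltW x0)//.
  have -> : \sum_(i < N) (1 / 2 : R) ^+ i = 2 - 2 * (1 / 2) ^+ N.
    elim: (N) => [|k IH]; first by rewrite big_ord0 expr0; ring.
    by rewrite big_ord_recr/= IH exprS; field.
  by rewrite lerBlDr lerDl mulr_ge0// exprn_ge0//; lra.
have := a0 _ x01; rewrite -cvg_shiftS => ax.
have axn : (fun N => `|a 0%N - \sum_(n < N.+1) x ^+ n * a n|) @ \oo
    --> `|a 0%N - 0|.
  by apply: cvg_norm; apply: cvgB => //; exact: cvg_cst.
rewrite subr0 in axn.
rewrite -(cvg_lim _ axn)//; apply: limr_le; first exact: cvgP axn.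
by apply: nearW.
Qed.

Lemma power_series_coef_eq0 (R : realType) (a : nat -> R) :
  (forall x : R, 0 < x < 1 ->
    (fun N => \sum_(n < N) x ^+ n * a n) @ \oo --> (0 : R)) ->
  forall n, a n = 0.
Proof.
move=> a0 n; elim: n a a0 => [|n IH] a a0; first exact: power_series_const_eq0.
(* dividing by x shifts the coefficients; this is why x = 0 is excluded *)
apply: (IH (fun n => a n.+1)) => x x01.
have [x_gt0 _] := andP x01.
have -> : (fun N => \sum_(n < N) x ^+ n * a n.+1) =
    (fun N => x^-1 * \sum_(n < N.+1) x ^+ n * a n).
  apply/funext => N.
  rewrite big_ord_recl (power_series_const_eq0 a0) mulr0 add0r.
  rewrite mulr_sumr; apply: eq_bigr => i _.
  by rewrite lift0 exprS !mulrA mulVf ?mul1r// gt_eqF.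
rewrite -[X in _ --> X](mulr0 x^-1); apply: cvgM; first exact: cvg_cst.
by have := a0 _ x01; rewrite -cvg_shiftS.
Qed.

Section SlicePowerSeries.
Context {R : realType}.
Implicit Types (f g : ballq R -> quat R) (c d : nat -> quat R).

Lemma has_power_series_coefB_cvg0 f c d (q : ballq R) :
  has_power_series f c -> has_power_series f d ->
  (fun N => `|\sum_(n < N) val q ^+ n * (c n - d n)|) @ \oo --> (0 : R).
Proof.
move=> /(_ q) fc /(_ q) fd.
have fcd : (fun N => `|f q - \sum_(n < N) val q ^+ n * c n|
    + `|f q - \sum_(n < N) val q ^+ n * d n|) @ \oo --> (0 : R).
  by rewrite -[X in _ --> X](addr0 (0 : R)); exact: cvgD fc fd.
apply: squeeze_cvgr (cvg_cst 0) fcd; apply: nearW => N.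
rewrite normr_ge0/=.
have -> : \sum_(n < N) val q ^+ n * (c n - d n) =
    (f q - \sum_(n < N) val q ^+ n * d n)
    - (f q - \sum_(n < N) val q ^+ n * c n).
  rewrite opprB addrC addrA subrK -sumrB; apply: eq_bigr => n _.
  by rewrite mulrBr.
by rewrite (le_trans (ler_normB _ _))// addrC.
Qed.

(** At a real point [x *: 1] the powers of the variable are real, so that each
of the four coordinates of the series is a real power series in [x]. *)
Lemma has_power_series_coef_inj f c d :
  has_power_series f c -> has_power_series f d -> c = d.
Proof.
move=> fc fd.
suff coord (pi : {linear quat R -> R^o}) : (forall q, `|pi q| <= `|q|) ->
    forall n, pi (c n) = pi (d n).
  apply/funext => n; apply: quat_eq.
  - by apply: (coord (@q0 R)) => q; case: (normr_coord_le q).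
  - by apply: (coord (@q1 R)) => q; case: (normr_coord_le q).
  - by apply: (coord (@q2 R)) => q; case: (normr_coord_le q).
  - by apply: (coord (@q3 R)) => q; case: (normr_coord_le q).
move=> pi_le n; apply/eqP; rewrite -subr_eq0 -raddfB; apply/eqP; move: n.
apply: (@power_series_coef_eq0 _ (fun n => pi (c n - d n))) => x /andP[x0 x1].
have xB : `|x *: (1 : quat R)| < 1 by rewrite normq_real gtr0_norm.
have cd0 := has_power_series_coefB_cvg0
  (exist (fun q : quat R => `|q| < 1) _ xB) fc fd.
apply/norm_cvg0P; apply: squeeze_cvgr (cvg_cst 0) cd0.
apply: nearW => N; rewrite normr_ge0/=.
have -> : \sum_(n < N) x ^+ n * pi (c n - d n) =
    pi (\sum_(n < N) (x *: (1 : quat R)) ^+ n * (c n - d n)).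
  rewrite raddf_sum; apply: eq_bigr => n _.
  rewrite exprZn expr1n -scalerAl mul1r; apply/esym; exact: linearZ.
exact: pi_le.
Qed.

Lemma has_power_series_sum_inj f g c :
  has_power_series f c -> has_power_series g c -> f = g.
Proof.
move=> fc gc; apply/funext => q; apply/eqP; rewrite -subr_eq0 -normr_le0.
have fgc : (fun N => `|f q - \sum_(n < N) val q ^+ n * c n|
    + `|g q - \sum_(n < N) val q ^+ n * c n|) @ \oo --> (0 : R).
  by rewrite -[X in _ --> X](addr0 (0 : R)); exact: cvgD (fc q) (gc q).
rewrite -(cvg_lim _ fgc)//; apply: limr_ge; first exact: cvgP fgc.
apply: nearW => N; rewrite (le_trans _ (ler_normB _ _))//.
by rewrite opprB addrA subrK.
Qed.

Lemma dilation_graph_single_valued (alpha : R) (theta : quat R) :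
  single_valued (dilation_graph alpha theta).
Proof.
move=> f g h [c [_ fc _ gc]] [d [_ fd _ hd]].
rewrite (has_power_series_coef_inj fd fc) in hd.
exact: has_power_series_sum_inj gc hd.
Qed.

(** The maximal domain makes the condition symmetric in the two functions: both
[c] and [theta ^+ n * c n] are required to be Bergman coefficients, and [c] is
recovered from the latter by multiplying with [theta^-1 ^+ n]. *)
Lemma dilation_graphV (alpha : R) (theta : quat R) : theta != 0 ->
  ((dilation_graph alpha theta)^-1 =
    dilation_graph alpha (theta^-1)%R)%relation.
Proof.
have sub (eta : quat R) : eta != 0 ->
    ((dilation_graph alpha eta)^-1 `<=`
      dilation_graph alpha (eta^-1)%R)%relation.
  move=> eta0 [g f] [c [bc fc bd gd]].
  exists (fun n => eta ^+ n * c n).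
  have -> : (fun n => eta^-1 ^+ n * (eta ^+ n * c n)) = c.
    by apply/funext => n; rewrite mulrA exprVn mulVr ?unitrX// mul1r.
  by [].
move=> theta0; apply/seteqP; split; first exact: sub.
move=> [g f] fg; have := sub theta^-1; rewrite invrK => /(_ _ (f, g) fg).
by apply; rewrite invr_eq0.
Qed.

End SlicePowerSeries.

(** * The density of the Gamma integral *)

Lemma powR_le_expR (R : realType) (p y : R) : 0 < p -> 0 <= y ->
  y `^ p <= p `^ p * expR y.
Proof.
move=> p0 y0; rewrite -{1}(divfK (lt0r_neq0 p0) y) mulrC.
rewrite powRM ?(ltW p0) ?divr_ge0 ?(ltW p0)// ler_wpM2l ?powR_ge0//.
have -> : expR y = expR (y / p) `^ p by rewrite -expRM divfK ?gt_eqF.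
rewrite ge0_ler_powR ?(ltW p0) ?nnegrE ?divr_ge0 ?expR_ge0 ?(ltW p0)//.
by rewrite (le_trans _ (expR_ge1Dx _))// lerDr.
Qed.

Section GammaDensity.
Context {R : realType}.
Local Notation mu := (@lebesgue_measure R).
Local Notation Rpos := (`]0, +oo[%classic : set R).
Implicit Types s t a : R.

Definition gamma_density s t : R := t `^ (s - 1) * expR (- t).

(** The derivative of [(t / (1 + t)) `^ s], a function with values in [0, 1];
it has the behaviour of [gamma_density] at 0 and a heavier tail, so it dominates
it for all [s > 0] at once, without splitting the half-line. *)
Definition gamma_majorant s t : R :=
  s * (t / (1 + t)) `^ (s - 1) * (1 + t) ^- 2.

Lemma gamma_density_ge0 s t : 0 <= gamma_density s t.
Proof. by rewrite mulr_ge0 ?powR_ge0 ?expR_ge0. Qed.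

Lemma measurable_gamma_density s D : measurable_fun D (gamma_density s).
Proof.
apply: measurable_funTS; apply: measurable_funM; first exact: measurable_powR.
by apply: measurableT_comp => //; exact: measurable_funN.
Qed.

Lemma gamma_density_le s t : 0 < s -> 0 < t ->
  gamma_density s t <=
    ((s + 1) `^ (s + 1) * expR 1 / s) * gamma_majorant s t.
Proof.
move=> s0 t0; have t1 : 0 < 1 + t by lra.
have -> : (s + 1) `^ (s + 1) * expR 1 / s * gamma_majorant s t
  = t `^ (s - 1) * ((s + 1) `^ (s + 1) * expR 1 / (1 + t) `^ (s + 1)).
  rewrite /gamma_majorant powRM ?invr_ge0 ?(ltW t0) ?(ltW t1)//.
  rewrite -(powR_inv1 (ltW t1)) -powRrM mulN1r.
  rewrite -(powR_mulrn 2 (ltW t1)) -!powRN.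
  have -> : - (s + 1) = - (s - 1) + - 2 by ring.
  rewrite [X in _ = _ * (_ * X)]powRD ?(gt_eqF t1) ?implybT//.
  by field; rewrite gt_eqF.
rewrite ler_wpM2l ?powR_ge0// ler_pdivlMr ?powR_gt0//.
rewrite expRN mulrC ler_pdivrMr ?expR_gt0// -mulrA -expRD.
by apply: powR_le_expR; lra.
Qed.

Lemma is_derive_divDr t : 0 < t ->
  is_derive t 1 (fun u : R => u / (1 + u)) ((1 + t) ^- 2).
Proof.
move=> t0; have t1 : 1 + t != 0 by lra.
have d1 : is_derive t 1 (fun u : R => (1 + u)^-1) (- (1 + t) ^- 2 *: (0 + 1)).
  by apply: is_deriveV => //; exact: is_deriveD.
apply: is_derive_eq (is_deriveM (is_derive_id t 1) d1) _.
by rewrite /GRing.scale/=; field.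
Qed.

Lemma is_derive_powR_divDr s t : 0 < t ->
  is_derive t 1 (fun u : R => (u / (1 + u)) `^ s) (gamma_majorant s t).
Proof.
move=> t0; have t1 : 0 < 1 + t by lra.
have q0 : 0 < t / (1 + t) by rewrite divr_gt0.
exact: (@is_derive1_comp _ (@powR R ^~ s) (fun u : R => u / (1 + u)) _ _ _
  (is_derive1_powR s q0) (is_derive_divDr t0)).
Qed.

Lemma continuous_gamma_majorant s t : 0 < t ->
  {for t, continuous (gamma_majorant s)}.
Proof.
move=> t0; have t1 : 0 < 1 + t by lra.
have [dp _] := is_derive_powR_divDr (s - 1) t0.
apply: cvgM; first apply: cvgM; first exact: cvg_cst.
  by have /derivable1_diffP/differentiable_continuous := dp.
apply: cvgV; first by rewrite expf_neq0// gt_eqF.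
under eq_cvg do rewrite expr2; rewrite expr2.
by apply: cvgM; apply: cvgD; (exact: cvg_cst || exact: cvg_id).
Qed.

Lemma integral_gamma_majorant_le1 s a : 0 < s -> 0 < a ->
  (\int[mu]_(t in `[a, +oo[) (gamma_majorant s t)%:E <= 1)%E.
Proof.
move=> s0 a0; pose F (t : R) := (t / (1 + t)) `^ s.
have dF (t : R) : 0 < t -> is_derive t 1 F (gamma_majorant s t).
  exact: is_derive_powR_divDr.
rewrite (@ge0_continuous_FTC2y _ _ F a 1).
- by rewrite -EFinB lee_fin gerBl powR_ge0.
- move=> x ax; rewrite !mulr_ge0 ?powR_ge0 ?(ltW s0) ?invr_ge0 ?exprn_ge0//.
  by lra.
- apply: continuous_in_subspaceT => x; rewrite inE/= in_itv/= andbT => ax.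
  by apply: continuous_gamma_majorant; lra.
- have -> : F = (@powR R ^~ s) \o (fun t : R => t / (1 + t)) by [].
  rewrite -[X in _ --> X](_ : 1 `^ s = 1); last by rewrite powR1.
  have [d1 _] := is_derive1_powR s (@ltr01 R).
  have /derivable1_diffP/differentiable_continuous cp := d1.
  suff cq : (t / (1 + t) : R) @[t --> +oo] --> (1 : R).
    exact: cvg_comp cq cp.
  suff cq : (1 - (1 + t)^-1 : R) @[t --> +oo] --> (1 - 0 : R).
    rewrite -[X in _ --> X](subr0 (1 : R)); apply: cvg_trans cq.
    apply: near_eq_cvg; near=> t.
    have t1 : 1 + t != 0 by apply: lt0r_neq0; rewrite ltr_pwDl.
    by field.
  apply: cvgB; first exact: cvg_cst.
  apply/gtr0_cvgV0; last exact: cvg_addrl.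
  by near=> t; rewrite ltr_pwDl.
- by move=> x ax; have /dF[] : 0 < x by lra.
- apply: cvg_at_right_filter.
  have [dFa _] := dF _ a0.
  by have /derivable1_diffP/differentiable_continuous := dFa.
- move=> x; rewrite in_itv/= andbT => ax.
  have /dF h : 0 < x by lra.
  by rewrite derive1E derive_val.
Unshelve. all: by end_near. Qed.

Lemma integral_gamma_density_lty s : 0 < s ->
  (\int[mu]_(t in Rpos) (gamma_density s t)%:E < +oo)%E.
Proof.
move=> s0; set C := (s + 1) `^ (s + 1) * expR 1 / s.
have C0 : 0 <= C by rewrite divr_ge0 ?mulr_ge0 ?powR_ge0 ?expR_ge0 ?ltW.
pose E n : set R := `[n.+1%:R^-1, +oo[%classic.
have E0 n : 0 < n.+1%:R^-1 :> R by [].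
have EE : Rpos = \bigcup_n E n.
  apply/seteqP; split => t /=; rewrite in_itv/= andbT.
    move=> t0; exists (Num.bound t^-1) => //.
    rewrite /E/= in_itv/= andbT invf_ple ?posrE//; apply/ltW.
    rewrite (lt_trans (archi_boundP _)) ?ltr_nat//.
    by rewrite invr_ge0 ltW.
  by move=> [n _]; rewrite /E/= in_itv/= andbT; apply: lt_le_trans.
have mE n : measurable (E n) by exact: measurable_itv.
have bnd n : (\int[mu]_(t in E n) (gamma_density s t)%:E <= C%:E)%E.
  have mh : measurable_fun (E n) (gamma_majorant s).
    apply: (@measurable_funS _ _ _ _ Rpos) => //.
      by move=> t; rewrite /E/= !in_itv/= !andbT; apply: lt_le_trans.
    apply: open_continuous_measurable_fun => // t.
    by rewrite inE/= in_itv/= andbT; exact: continuous_gamma_majorant.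
  have hp t : E n t -> 0 <= gamma_majorant s t.
    rewrite /E/= in_itv/= andbT => Et.
    have t0 : 0 <= t by apply: le_trans Et.
    by rewrite !mulr_ge0 ?powR_ge0 ?(ltW s0)// invr_ge0 exprn_ge0// addr_ge0.
  apply: (@le_trans _ _
      (\int[mu]_(t in E n) (C%:E * (gamma_majorant s t)%:E))%E).
    apply: ge0_le_integral => //.
    - exact: mE.
    - by move=> t Et; rewrite lee_fin gamma_density_ge0.
    - by apply/measurable_EFinP; exact: measurable_gamma_density.
    - by apply/measurable_EFinP; apply: measurable_funM.
    - move=> t; rewrite /E/= in_itv/= andbT => Et; rewrite -EFinM lee_fin.
      by apply: gamma_density_le => //; exact: lt_le_trans Et.
  rewrite ge0_integralZl_EFin//.
  - by rewrite -[leRHS]mule1 lee_wpmul2l ?lee_fin// integral_gamma_majorant_le1.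
  - exact: mE.
  - exact/measurable_EFinP.
rewrite EE; apply: (@le_lt_trans _ _ C%:E); last exact: ltry.
have cE : (\int[mu]_(t in E n) (gamma_density s t)%:E)%E @[n --> \oo] -->
    (\int[mu]_(t in \bigcup_n E n) (gamma_density s t)%:E)%E.
  apply: ge0_nondecreasing_set_cvg_integral => //.
  - move=> m n mn; apply/subsetPset => t; rewrite /E/= !in_itv/= !andbT.
    by apply: le_trans; rewrite lef_pV2 ?posrE// ler_nat.
  - by move=> n; apply/measurable_EFinP; exact: measurable_gamma_density.
  - by move=> n t Et; rewrite lee_fin gamma_density_ge0.
rewrite -(cvg_lim _ cE)//; apply: lime_le; first exact: cvgP cE.
by apply: nearW.
Qed.

Lemma integrable_gamma_density s : 0 < s ->
  mu.-integrable Rpos (EFin \o gamma_density s).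
Proof.
move=> s0; apply/integrableP; split.
  by apply/measurable_EFinP; exact: measurable_gamma_density.
apply: le_lt_trans (integral_gamma_density_lty s0).
rewrite le_eqVlt; apply/orP; left; apply/eqP; apply: eq_integral.
by move=> t _; rewrite /= ger0_norm// gamma_density_ge0.
Qed.

(** [Gamma] is the finite part of an extended-real integral, so that its
positivity needs the integral to be finite as well as nonzero. *)
Lemma Gamma_gt0 s : 0 < s -> 0 < Gamma s.
Proof.
move=> s0; have fin := integral_gamma_density_lty s0.
rewrite /Gamma /Rintegral fine_gt0//; apply/andP; split; last exact: fin.
rewrite lt0e integral_ge0 ?andbT; last first.
  by move=> t _; rewrite lee_fin gamma_density_ge0.
apply/eqP => i0.
have : ae_eq mu Rpos (EFin \o gamma_density s) (cst 0%E).
  apply/ae_eq_integral_abs => //.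
    by apply/measurable_EFinP; exact: measurable_gamma_density.
  rewrite -[RHS]i0; apply: eq_integral => t _.
  by rewrite /= ger0_norm// gamma_density_ge0.
move=> [N [mN N0 sN]].
have /(le_measure mu) : Rpos `<=` N.
  move=> t t0; apply: sN => /= /(_ t0); case; apply/eqP.
  move: t0; rewrite /= in_itv/= andbT => t0.
  by rewrite gt_eqF// mulr_gt0 ?powR_gt0 ?expR_gt0.
rewrite !inE => /(_ (measurable_itv _) mN).
rewrite [X in (_ <= X)%E]N0 [X in (X <= _)%E]lebesgue_measure_itv/=.
by rewrite ltry.
Qed.

End GammaDensity.

(** * Uniqueness for the Laplace transform on the half-line *)

Lemma expr1B_ge (R : realDomainType) (x : R) n : 0 <= x <= 1 ->
  1 - n%:R * x <= (1 - x) ^+ n.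
Proof.
move=> /andP[x0 x1]; elim: n => [|n IH]; first by rewrite mul0r subr0 expr0.
rewrite exprS; apply: (@le_trans _ _ ((1 - x) * (1 - n%:R * x))).
  rewrite -subr_ge0 -natr1.
  have -> : (1 - x) * (1 - n%:R * x) - (1 - (n%:R + 1) * x) = n%:R * x ^+ 2.
    by ring.
  by rewrite mulr_ge0 ?sqr_ge0.
by rewrite ler_wpM2l ?subr_ge0.
Qed.

(** The next two lemmas describe polynomials in [w] that approximate a step at
[w = 1 / 2]: the product of the exponent [2 ^ n] with [w ^+ n] is
[(2 * w) ^+ n], which tends to 0 below the threshold and to infinity above. *)
Lemma cvg_expr1B_small (R : realType) (w : R) : 0 <= w < 1 / 2 ->
  (fun n => (1 - w ^+ n) ^+ (2 ^ n)) @ \oo --> (1 : R).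
Proof.
move=> /andP[w0 w2].
have wn n : 0 <= w ^+ n <= 1 by rewrite exprn_ge0//= exprn_ile1//; lra.
apply: (@squeeze_cvgr _ _ _ _ (fun n => 1 - (2 * w) ^+ n) (fun=> 1)).
- apply: nearW => n; have /andP[wn0 wn1] := wn n.
  by rewrite exprMn -natrX expr1B_ge ?wn//= exprn_ile1//; lra.
- rewrite -[X in _ --> X](subr0 (1 : R)); apply: cvgB; first exact: cvg_cst.
  by apply: cvg_expr; rewrite ger0_norm ?mulr_ge0//; lra.
- exact: cvg_cst.
Qed.

Lemma cvg_expr1B_large (R : realType) (w : R) : 1 / 2 < w <= 1 ->
  (fun n => (1 - w ^+ n) ^+ (2 ^ n)) @ \oo --> (0 : R).
Proof.
move=> /andP[w2 w1]; have w0 : 0 < w by lra.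
have wn n : 0 <= w ^+ n <= 1.
  by rewrite exprn_ge0 ?(ltW w0)//= exprn_ile1//; lra.
apply: (@squeeze_cvgr _ _ _ _ (fun=> 0) (fun n => (2 * w)^-1 ^+ n)).
- apply: nearW => n; have /andP[wn0 wn1] := wn n.
  apply/andP; split; first by rewrite exprn_ge0// subr_ge0.
  have p0 : 0 < (2 * w) ^+ n by rewrite exprn_gt0//; lra.
  (* (1 - y)^m <= exp(- m y) <= 1 / (m y) with y = w^n and m = 2^n *)
  apply: (@le_trans _ _ (expR (- w ^+ n) ^+ (2 ^ n))).
    by rewrite lerXn2r ?nnegrE ?subr_ge0 ?expR_ge0// expR_ge1Dx.
  rewrite -expRM_natl mulrN natrX -exprMn expRN exprVn.
  rewrite lef_pV2 ?posrE ?expR_gt0//.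
  by rewrite (le_trans _ (expR_ge1Dx _))// lerDr.
- exact: cvg_cst.
- apply: cvg_expr; rewrite ger0_norm ?invr_ge0 ?mulr_ge0 ?(ltW w0)//.
  by rewrite invf_lt1; lra.
Qed.

Section LaplaceTransform.
Context {R : realType}.
Local Notation mu := (@lebesgue_measure R).
Local Notation Rpos := (`]0, +oo[%classic : set R).
Implicit Types (s t a : R) (g : R -> R).

Lemma measurable_expRNM s D : measurable_fun D (fun t => expR (- (s * t))).
Proof.
apply: measurable_funTS; apply: measurableT_comp => //.
by apply: measurable_funN; exact: measurable_funM.
Qed.

Lemma expRNM_le1 s t : 0 <= s -> 0 <= t -> expR (- (s * t)) <= 1.
Proof. by move=> s0 t0; rewrite expR_le1 oppr_le0 mulr_ge0. Qed.

Lemma integrable_mul_expRNM g s : 0 <= s ->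
  mu.-integrable Rpos (EFin \o g) ->
  mu.-integrable Rpos (fun t => (g t * expR (- (s * t)))%:E).
Proof.
move=> s0 gi; apply: le_integrable (gi) => //.
  apply/measurable_EFinP; apply: measurable_funM.
    by apply/measurable_EFinP; case/integrableP: gi.
  exact: measurable_expRNM.
move=> t; rewrite /= in_itv/= andbT => t0.
rewrite lee_fin normrM ler_piMr// ger0_norm ?expR_ge0//.
by rewrite expRNM_le1// ltW.
Qed.

Section Uniqueness.
Variable g : R -> R.
Hypothesis g_int : mu.-integrable Rpos (EFin \o g).
Hypothesis g_laplace : forall s, 0 <= s ->
  \int[mu]_(t in Rpos) (g t * expR (- (s * t))) = 0.

(** The factor [expR (- (s * t))] is there for the induction on [n]: expanding
one factor [1 - expR (- (r * t))] replaces [s] by [s + r]. *)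
Lemma integral_laplace_poly_eq0 (r : R) n s : 0 <= r -> 0 <= s ->
  mu.-integrable Rpos
    (fun t => (g t * expR (- (s * t)) * (1 - expR (- (r * t))) ^+ n)%:E) /\
  \int[mu]_(t in Rpos)
    (g t * expR (- (s * t)) * (1 - expR (- (r * t))) ^+ n) = 0.
Proof.
move=> r0; elim: n s => [|n IH] s s0.
  split; last first.
    by under eq_Rintegral do rewrite expr0 mulr1; exact: g_laplace.
  apply: eq_integrable (integrable_mul_expRNM s0 g_int) => // t _.
  by rewrite expr0 mulr1.
have [i1 e1] := IH s s0; have [i2 e2] := IH (s + r) (addr_ge0 s0 r0).
have E t : g t * expR (- (s * t)) * (1 - expR (- (r * t))) ^+ n.+1 =
    g t * expR (- (s * t)) * (1 - expR (- (r * t))) ^+ n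
    - g t * expR (- ((s + r) * t)) * (1 - expR (- (r * t))) ^+ n.
  by rewrite mulrDl opprD expRD exprS; ring.
split; last first.
  by under eq_Rintegral do rewrite E; rewrite RintegralB// e1 e2 subrr.
apply: eq_integrable (integrableB _ i1 i2) => // t _.
by rewrite E EFinB.
Qed.

Lemma integral_tail_eq0 a : 0 < a -> \int[mu]_(t in `]a, +oo[) g t = 0.
Proof.
(* the rate c places the threshold expR (- (c * t)) = 1 / 2 at t = a *)
move=> a0; pose c := ln 2 / a.
have ln2 : 0 < ln 2 :> R by rewrite ln_gt0// ltr1n.
have c0 : 0 < c by rewrite divr_gt0.
have nc0 n : 0 <= n%:R * c by rewrite mulr_ge0// ltW.
have ca : expR (- (c * a)) = 1 / 2.
  by rewrite /c divfK ?gt_eqF// expRN lnK ?posrE// div1r.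
pose f_ n (t : R) := (g t * (1 - expR (- ((n%:R * c) * t))) ^+ (2 ^ n))%:E.
have mg : measurable_fun Rpos g.
  by apply/measurable_EFinP; case/integrableP: g_int.
have powE n t : expR (- ((n%:R * c) * t)) = expR (- (c * t)) ^+ n.
  by rewrite -mulrA -mulrN expRM_natl.
have [] := @dominated_convergence _ _ R mu Rpos _ f_
    (EFin \o (g \_ `]a, +oo[)) (EFin \o (Num.norm \o g)).
- exact: measurable_itv.
- move=> n; apply/measurable_EFinP; apply: measurable_funM => //.
  apply: measurable_funX; apply: measurable_funB => //.
  exact: measurable_expRNM.
- apply/measurable_EFinP; apply/measurable_restrict => //.
  by apply: measurable_funS mg => // t [].
- exists [set a]; split;
    [exact: measurable_set1|exact: lebesgue_measure_set1|].
  move=> t /=; apply: contra_notP => ta; rewrite in_itv/= andbT => t0.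
  apply: cvg_EFin; first by apply: nearW.
  have [at_|ta_] := ltP a t.
    rewrite patchE mem_set/= ?in_itv/= ?at_//.
    rewrite -[X in _ --> X](mulr1 (g t)); apply: cvgM; first exact: cvg_cst.
    under eq_cvg do rewrite powE; apply: cvg_expr1B_small.
    by rewrite expR_ge0/= -ca ltr_expR ltrN2 ltr_pM2l.
  have {}ta_ : t < a by rewrite lt_neqAle ta_ andbT; apply/eqP.
  rewrite patchE memNset/= ?in_itv/=; last by rewrite ltNge (ltW ta_).
  rewrite -[X in _ --> X](mulr0 (g t)); apply: cvgM; first exact: cvg_cst.
  under eq_cvg do rewrite powE; apply: cvg_expr1B_large.
  by rewrite -ca ltr_expR ltrN2 ltr_pM2l// ta_/= expRNM_le1// ltW.
- exact: integrable_norm.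
- apply: aeW => t n; rewrite /= in_itv/= andbT => t0.
  rewrite lee_fin normrM ler_piMr// normrX exprn_ile1// ler_norml.
  have := expRNM_le1 (nc0 n) (ltW t0).
  by have := expR_ge0 (- (n%:R * c * t)); lra.
- move=> fint _ fcvg.
have f0 n : (\int[mu]_(t in Rpos) f_ n t)%E = 0%E.
  have [i e] := integral_laplace_poly_eq0 (2 ^ n) (nc0 n) (lexx 0).
  have fi : mu.-integrable Rpos (f_ n).
    by apply: eq_integrable i => // t _; rewrite mul0r oppr0 expR0 mulr1.
  rewrite -[LHS]fineK; last exact: integrable_fin_num.
  congr EFin; rewrite -[RHS]e; apply: eq_Rintegral => t _.
  by rewrite mul0r oppr0 expR0 mulr1.
have f0s : [sequence (\int[mu]_(t in Rpos) f_ n t)%E]_n = cst 0%E.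
  exact/funext.
rewrite f0s in fcvg.
have -> : `]a, +oo[%classic = Rpos `&` `]a, +oo[.
  by apply/esym/setIidr => t; rewrite /= !in_itv/= !andbT; apply: lt_trans.
by rewrite Rintegral_mkcondr /Rintegral -(cvg_lim _ fcvg)// lim_cst.
Qed.

(** The integral of [g] over every interval from 0 vanishes, and the derivative
of this primitive is [g] almost everywhere. *)
Lemma laplace_eq0_ae : {ae mu, forall t, Rpos t -> g t = 0}.
Proof.
have gi y : mu.-integrable `]0, y] (EFin \o (g \_ Rpos)).
  have gi : mu.-integrable `]0, y] (EFin \o g).
    by apply: integrableS g_int => //; apply: subset_itvl; rewrite bnd_simp.
  apply: eq_integrable gi => // t; rewrite inE => ty.
  rewrite /= patchE mem_set//.
  by move: ty; rewrite /= !in_itv/= andbT => /andP[].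
have := FTC1 gi (integrable_locally (measurable_itv _) g_int).
apply: filterS; first exact: (ae_filter_ringOfSetsType mu).
move=> x /= h; rewrite in_itv/= andbT => x0.
have [] := h; first by rewrite lte_fin.
set F := (fun _ => _).
have -> : F = cst 0.
  apply/funext => y; rewrite /F.
  have [y0|y0] := leP y 0.
    by rewrite set_itv_ge ?Rintegral_set0// -leNgt bnd_simp.
  transitivity (\int[mu]_(t in `]0, y]) g t).
    apply: eq_Rintegral => t; rewrite inE => ty; rewrite patchE mem_set//.
    by move: ty; rewrite /= !in_itv/= andbT => /andP[].
  have := @Rintegral_itvB _ g (BRight 0) +oo%O y g_int.
  rewrite !bnd_simp ltW// => /(_ isT isT); rewrite (integral_tail_eq0 y0).
  move=> /eqP; rewrite subr_eq0 => /eqP <-.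
  rewrite -[RHS](g_laplace (lexx 0)); apply: eq_Rintegral => t _.
  by rewrite mul0r oppr0 expR0 mulr1.
move=> _.
by rewrite derive1_cst patchE mem_set => [<-|]; rewrite ?/= ?in_itv/= ?x0.
Qed.

End Uniqueness.
End LaplaceTransform.

(** * Injectivity of the second Bargmann transform *)

Section BargmannInjective.
Context {R : realType} (alpha : R).
Hypothesis alpha_gt0 : 0 < alpha.
Local Notation mu := (@lebesgue_measure R).
Local Notation Rpos := (`]0, +oo[%classic : set R).

Let w (t : R) : R := t `^ alpha * expR (- t).

Let w_ge0 t : 0 <= w t.
Proof. by rewrite mulr_ge0 ?powR_ge0 ?expR_ge0. Qed.

Let w_int : mu.-integrable Rpos (EFin \o w).
Proof.
have := @integrable_gamma_density R (alpha + 1) (addr_gt0 alpha_gt0 ltr01).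
by rewrite /gamma_density addrK.
Qed.

Let w_measurable : measurable_fun Rpos w.
Proof. by apply/measurable_EFinP; case/integrableP : w_int. Qed.

(** The weight [w] has finite mass, so that [w * |phi|] is dominated by the
integrable function [w + w * |phi|^2]. *)
Lemma integrable_weight_coord (phi : R -> quat R) (coo : quat R -> R) :
  square_integrable alpha phi -> measurable_fun Rpos (coo \o phi) ->
  (forall q, `|coo q| <= `|q|) ->
  mu.-integrable Rpos (fun t => (w t * coo (phi t))%:E).
Proof.
move=> [m0 m1 m2 m3 fin] mcoo coo_le.
pose N t := `|phi t| ^+ 2 * t `^ alpha * expR (- t).
have NE t : N t = sqnormq (phi t) * w t by rewrite /N sqr_normq -mulrA.
have N_ge0 t : 0 <= N t by rewrite NE mulr_ge0 ?sqnormq_ge0.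
have mN : measurable_fun Rpos N.
  rewrite (_ : N = (fun t => sqnormq (phi t) * w t)); last exact/funext.
  apply: measurable_funM => //; rewrite /sqnormq.
  do 3 (apply: measurable_funD; last exact: measurable_funX).
  exact: measurable_funX.
have N_int : mu.-integrable Rpos (EFin \o N).
  apply/integrableP; split; first exact/measurable_EFinP.
  apply: le_lt_trans fin; rewrite le_eqVlt; apply/orP; left; apply/eqP.
  by apply: eq_integral => t _; rewrite /= ger0_norm.
have wN_int : mu.-integrable Rpos (fun t => (w t + N t)%:E).
  by apply: eq_integrable (integrableD _ w_int N_int).
apply: le_integrable wN_int => //.
  by apply/measurable_EFinP; exact: measurable_funM.
move=> t _; rewrite lee_fin normrM (ger0_norm (w_ge0 t)).
rewrite [leRHS]ger0_norm ?addr_ge0//.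
rewrite NE -sqr_normq mulrC -[X in X + _]mul1r -mulrDl ler_wpM2r//.
apply: (le_trans (coo_le _)).
rewrite -subr_ge0; have -> : 1 + `|phi t| ^+ 2 - `|phi t| =
  (`|phi t| - 1 / 2) ^+ 2 + 3 / 4 by field.
by rewrite addr_ge0 ?sqr_ge0//; lra.
Qed.

Lemma real_point_lt1 (s : R) : 0 <= s -> `|(s / (1 + s)) *: (1 : quat R)| < 1.
Proof.
move=> s0; rewrite normq_real ger0_norm ?divr_ge0 ?addr_ge0//.
by rewrite ltr_pdivrMr ?ltr_pwDl//; lra.
Qed.

(** The point with [q / (q - 1) = - s]. *)
Definition real_point (s : R) (s0 : 0 <= s) : ballq R :=
  exist (fun q : quat R => `|q| < 1) _ (real_point_lt1 s0).

Lemma bargmann_real (phi : L2 alpha) (s : R) (s0 : 0 <= s) :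
  bargmann alpha phi (real_point s0) =
  ((Num.sqrt (pi * Gamma alpha))^-1 *
    (expR ((alpha + 1) * ln (1 + s)^-1))^-1) *:
  integralq Rpos (fun t => (w t * expR (- (s * t))) *: L2_fun phi t).
Proof.
have s1 : 1 + s != 0 by apply: lt0r_neq0; lra.
rewrite /bargmann /=; set x := _ *: 1.
have -> : 1 - x = (1 + s)^-1 *: 1.
  rewrite /x -{1}(scale1r (1 : quat R)) -scalerBl.
  by congr (_ *: _); field.
rewrite powq_real; last by rewrite invr_gt0; lra.
have -> : x - 1 = (- (1 + s)^-1) *: 1.
  rewrite /x -{2}(scale1r (1 : quat R)) -scalerBl.
  by congr (_ *: _); field.
rewrite !invq_real ?oppr_eq0 ?invr_eq0 ?expR_eq0//.
rewrite scalerA -scalerAl mul1r; congr (_ *: integralq _ _).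
apply/funext => t.
have -> : x * ((- (1 + s)^-1)^-1 *: 1) = (- s) *: 1.
  rewrite /x -scalerAl mul1r scalerA; congr (_ *: _).
  by rewrite invrN invrK; field.
rewrite scalerA expq_real -scalerAl mul1r scalerA.
by congr (_ * expR _ *: _); ring.
Qed.

Lemma bargmann_inj : injective (bargmann alpha).
Proof.
move=> phi psi e.
have eI (s : R) : 0 <= s ->
    integralq Rpos (fun t => (w t * expR (- (s * t))) *: L2_fun phi t) =
    integralq Rpos (fun t => (w t * expR (- (s * t))) *: L2_fun psi t).
  move=> s0; have := congr1 (fun f => f (real_point s0)) e.
  rewrite /= !bargmann_real => /scalerI; apply.
  rewrite mulf_neq0 ?invr_eq0 ?expR_eq0// sqrtr_eq0 -ltNge.
  by rewrite mulr_gt0 ?pi_gt0//; exact: Gamma_gt0.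
have phiL := set_mem (valP (repr phi)).
have psiL := set_mem (valP (repr psi)).
rewrite -/(L2_fun phi) in phiL; rewrite -/(L2_fun psi) in psiL.
have coord (coo : quat R -> R) :
    (forall a q, coo (a *: q) = a * coo q) -> (forall q, `|coo q| <= `|q|) ->
    measurable_fun Rpos (coo \o L2_fun phi) ->
    measurable_fun Rpos (coo \o L2_fun psi) ->
    (forall s, 0 <= s ->
      \int[mu]_(t in Rpos) coo ((w t * expR (- (s * t))) *: L2_fun phi t) =
      \int[mu]_(t in Rpos) coo ((w t * expR (- (s * t))) *: L2_fun psi t)) ->
    {ae mu, forall t, Rpos t -> coo (L2_fun phi t) = coo (L2_fun psi t)}.
  move=> cooZ coo_le mphi mpsi ecoo.
  have iphi := integrable_weight_coord phiL mphi coo_le.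
  have ipsi := integrable_weight_coord psiL mpsi coo_le.
  have gi : mu.-integrable Rpos
      (EFin \o (fun t => w t * coo (L2_fun phi t) - w t * coo (L2_fun psi t))).
    exact: eq_integrable (integrableB _ iphi ipsi).
  have : forall s, 0 <= s -> \int[mu]_(t in Rpos)
     ((w t * coo (L2_fun phi t) - w t * coo (L2_fun psi t))
       * expR (- (s * t))) = 0.
    move=> s s0.
    under eq_Rintegral do rewrite mulrBl.
    rewrite RintegralB//; last 2 first.
      exact: integrable_mul_expRNM.
      exact: integrable_mul_expRNM.
    apply/eqP; rewrite subr_eq0; apply/eqP.
    have := ecoo s s0; under eq_Rintegral do rewrite cooZ mulrAC.
    by move=> ->; apply: eq_Rintegral => t _; rewrite cooZ mulrAC.
  move=> /(laplace_eq0_ae gi).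
  apply: filterS; first exact: (ae_filter_ringOfSetsType mu).
  move=> t /= wt0 t0; have := wt0 t0; rewrite -mulrBr => /eqP.
  rewrite mulf_eq0 gt_eqF/=; first by rewrite subr_eq0 => /eqP.
  move: t0; rewrite in_itv/= andbT => t0.
  by rewrite mulr_gt0 ?powR_gt0 ?expR_gt0.
rewrite -(reprK phi) -(reprK psi); apply/eqquotP/asboolP.
have [m0 m1 m2 m3 _] := phiL; have [n0 n1 n2 n3 _] := psiL.
have c0 := coord (@q0 R) (fun _ _ => erefl)
  (fun q => let: And4 h _ _ _ := normr_coord_le q in h) m0 n0
  (fun s s0 => congr1 (@q0 R) (eI s s0)).
have c1 := coord (@q1 R) (fun _ _ => erefl)
  (fun q => let: And4 _ h _ _ := normr_coord_le q in h) m1 n1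
  (fun s s0 => congr1 (@q1 R) (eI s s0)).
have c2 := coord (@q2 R) (fun _ _ => erefl)
  (fun q => let: And4 _ _ h _ := normr_coord_le q in h) m2 n2
  (fun s s0 => congr1 (@q2 R) (eI s s0)).
have c3 := coord (@q3 R) (fun _ _ => erefl)
  (fun q => let: And4 _ _ _ h := normr_coord_le q in h) m3 n3
  (fun s s0 => congr1 (@q3 R) (eI s s0)).
have F : Filter (nbhs (almost_everywhere mu)) := ae_filter_ringOfSetsType mu.
have c01 := @filterI _ _ F _ _ c0 c1; have c23 := @filterI _ _ F _ _ c2 c3.
have := @filterI _ _ F _ _ c01 c23; apply: (@filterS _ _ F).
move=> t /= [[h0 h1] [h2 h3]] t0.
by apply: quat_eq; [exact: h0|exact: h1|exact: h2|exact: h3].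
Qed.

End BargmannInjective.

(** * The inverse of the transform *)

Theorem proposition3p4 (R : realType) (alpha : R) (theta : quat R) :
  (0 < alpha)%R -> theta <> 0%R ->
  [/\ single_valued (Ltilde alpha theta),
      single_valued ((Ltilde alpha theta)^-1)%relation,
      ((Ltilde alpha theta)^-1 =
        (bargmann_graph alpha)^-1 \; (dilation_graph alpha theta)^-1 \;
          bargmann_graph alpha)%relation &
      ((Ltilde alpha theta)^-1)%relation = Ltilde alpha (theta^-1)%R].
Proof.
move=> alpha0 /eqP theta0.
have sv (eta : quat R) : single_valued (Ltilde alpha eta).
  move=> phi psi psi' [g [f [_ fE] fg] [_ gE]] [g' [f' [_ f'E] fg'] [_ g'E]].
  move: fE gE f'E g'E => /= fE gE f'E g'E.
  apply: (bargmann_inj alpha0); rewrite -gE -g'E.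
  by rewrite f'E -fE in fg'; exact: dilation_graph_single_valued fg fg'.
have inv : ((Ltilde alpha theta)^-1 = (bargmann_graph alpha)^-1 \;
    (dilation_graph alpha theta)^-1 \; bargmann_graph alpha)%relation.
  apply/seteqP; split => -[psi phi] [g [f ? ?] ?];
    by exists f => //; exists g.
have invV : ((Ltilde alpha theta)^-1)%relation = Ltilde alpha (theta^-1)%R.
  by rewrite inv /Ltilde -(dilation_graphV alpha theta0).
by split => //; rewrite invV.
Qed.
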